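(* There exists an absolute constant $C>0$ such that the following holds for all $n\geq 3$. Let $\mathfrak{X}=(\Omega,S)$ be a scheme on $n=|\Omega|$ points and let $a\in S^\cup$ be a connected relation such that $aa^*=a^*a$. Then \[ \overrightarrow{\mathrm{diam}}(a)\leq C\cdot\mathrm{diam}(a)\log\log n, \] i.e. $\overrightarrow{\mathrm{diam}}(a)=O(\mathrm{diam}(a)\log\log n)$.
   Context: Let $\Omega$ be a finite set. For relations $a,b\subseteq\Omega\times\Omega$ the product is $ab=\{(\alpha,\beta)\mid(\alpha,\gamma)\in a,\ (\gamma,\beta)\in b\text{ for some }\gamma\in\Omega\}$, the transpose is $a^*=\{(\beta,\alpha)\mid(\alpha,\beta)\in a\}$, and $1_\Omega=\{(\alpha,\alpha)\mid\alpha\in\Omega\}$. A scheme (homogeneous coherent configuration) is a pair $\mathfrak{X}=(\Omega,S)$ where $S$ is a partition of $\Omega\times\Omega$ into relations such that: (1) $1_\Omega\in S$; (2) if $a\in S$ then $a^*\in S$; (3) for any $a,b,c\in S$ the number $|\{\gamma\in\Omega\mid(\alpha,\gamma)\in b,\ (\gamma,\beta)\in c\}|$ does not depend on the choice of $(\alpha,\beta)\in a$. $S^\cup$ denotes the set of all unions of relations from $S$. Relations on $\Omega$ are viewed as directed graphs on the vertex set $\Omega$. The directed diameter $\overrightarrow{\mathrm{diam}}(a)$ is the maximum over ordered pairs of vertices of the length of a shortest path respecting edge orientations; the undirected diameter is $\mathrm{diam}(a)=\overrightarrow{\mathrm{diam}}(a\cup a^* )$. Connected means that any two vertices are joined by a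 path ignoring orientations; for $a\in S^\cup$ this is equivalent to strong connectivity, so the directed diameter is finite. $\log$ is the base-2 logarithm. *)

(* Defs.v *)
From mathcomp Require Import all_boot all_order all_algebra.
From mathcomp Require Import reals exp.

Set Implicit Arguments.
Unset Strict Implicit.
Unset Printing Implicit Defensive.

Import Order.TTheory GRing.Theory Num.Theory.

Section Relations.
Variable T : finType.
Implicit Types (a b : {set T * T}) (x y : T).

Definition relmul a b : {set T * T} :=
  [set p | [exists z, ((p.1, z) \in a) && ((z, p.2) \in b)]].

Definition reltr a : {set T * T} := [set p | (p.2, p.1) \in a].

Definition relid : {set T * T} := [set p | p.1 == p.2].

Definition arc a : rel T := fun x y => (x, y) \in a.

Definition rel_connected a : Prop :=
  forall x y, connect (arc (a :|: reltr a)) x y.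

Definition walk_of_length a x y (k : nat) : bool :=
  [exists p : k.-tuple T, path (arc a) x p && (last x p == y)].

(* [find] returns the least k < #|T| with a walk of length k from x to y, and
   #|T| if there is none.  A shortest path has length < #|T| (see
   [ddist_connect]), so the value #|T| means that y is unreachable from x. *)
Definition ddist a x y : nat := find (walk_of_length a x y) (iota 0 #|T|).

Definition ddiam a : nat := \max_(x : T) \max_(y : T) ddist a x y.

Definition diam a : nat := ddiam (a :|: reltr a).

Lemma ddist_connect a x y : (ddist a x y < #|T|) = connect (arc a) x y.
Proof.
rewrite /ddist -[X in _ < X](size_iota 0) -has_find; apply/hasP/connectP.
  case=> k _ /existsP[p /andP[pth /eqP lst]].
  by exists p.
case=> p /shortenP[q pth uq _] ->; exists (size q).
  by rewrite mem_iota /= -[(size q).+1]/(size (x :: q)) -(card_uniqP uq) max_card.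
by apply/existsP; exists (in_tuple q); rewrite /= pth eqxx.
Qed.

Lemma ddist_walk a x y : connect (arc a) x y ->
  exists p, [/\ path (arc a) x p, last x p = y & size p = ddist a x y].
Proof.
rewrite -ddist_connect => lt_d.
have := lt_d; rewrite {1}/ddist -[X in _ < X](size_iota 0) -has_find.
move=> /(nth_find 0); rewrite -/(ddist a x y) nth_iota //= add0n.
case/existsP=> p /andP[pth /eqP lst]; exists p; split=> //.
exact: size_tuple.
Qed.

Lemma ddist_min a x p : path (arc a) x p -> ddist a x (last x p) <= size p.
Proof.
move=> pth; case: (ltnP (size p) #|T|) => [lt_p|le_p]; last first.
  by apply: leq_trans le_p; rewrite -[X in _ <= X](size_iota 0) find_size.
rewrite leqNgt; apply/negP => /(before_find 0); rewrite nth_iota // add0n.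
by move/negbT/negP; apply; apply/existsP; exists (in_tuple p); rewrite /= pth eqxx.
Qed.

Record is_scheme (S : {set {set T * T}}) : Prop := IsScheme {
  scheme_partition : partition S [set: T * T];
  scheme_id : relid \in S;
  scheme_tr : forall a, a \in S -> reltr a \in S;
  scheme_intersection_number : forall a b c, a \in S -> b \in S -> c \in S ->
    exists k : nat, forall x y, (x, y) \in a ->
      #|[set z | ((x, z) \in b) && ((z, y) \in c)]| = k }.

Definition scheme_unions (S : {set {set T * T}}) : {set {set T * T}} :=
  [set cover B | B in powerset S].

End Relations.

Definition log2 (R : realType) (x : R) : R := (ln x / ln 2)%R.

(* Main.v *)
(** Put [c = a U 1] and [d = diam a].  Since [c] commutes with its transpose [e],
    every undirected walk can be sorted, so [c^d e^d] is the full relation.  A Ruzsa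
    triangle inequality for valencies then gives [n |c^m| <= |c^(m+d)|^2]; hence
    [n / |c^(kd)| <= n^(1/2^k)], which drops below 2 once [2^(2^k) > n].  Then any
    out-ball [x c^(kd)] meets any in-ball [y e^(kd)], so [ddiam a <= 2 k d]. *)
Require Import Defs.
From mathcomp Require Import all_boot all_order all_algebra.
From mathcomp Require Import reals exp.

Set Implicit Arguments.
Unset Strict Implicit.
Unset Printing Implicit Defensive.

(** * Product, transpose and identity of relations *)

Section RelationAlgebra.
Variable T : finType.
Implicit Types (a b c u v w : {set T * T}) (x y z : T).

Lemma relmulP a b x y :
  reflect (exists2 z, (x, z) \in a & (z, y) \in b) ((x, y) \in relmul a b).
Proof.
rewrite inE /=; apply: (iffP existsP) => [[z /andP[? ?]]|[z ? ?]]; exists z => //.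
exact/andP.
Qed.

Lemma reltrE a x y : ((x, y) \in reltr a) = ((y, x) \in a).
Proof. by rewrite inE. Qed.

Lemma relidE x y : ((x, y) \in relid T) = (x == y).
Proof. by rewrite inE. Qed.

Lemma relP a b : (forall x y, ((x, y) \in a) = ((x, y) \in b)) -> a = b.
Proof. by move=> eq_ab; apply/setP=> -[x y]. Qed.

Lemma relmulA : associative (@relmul T).
Proof.
move=> a b c; apply: relP => x y; apply/relmulP/relmulP.
  by case=> z xz /relmulP[t zt ty]; exists t => //; apply/relmulP; exists z.
by case=> z /relmulP[t xt tz] zy; exists t => //; apply/relmulP; exists z.
Qed.

Lemma relmul1r : left_id (relid T) (@relmul T).
Proof.
move=> a; apply: relP => x y; apply/relmulP/idP => [[z]|xy].
  by rewrite relidE => /eqP->.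
by exists x; rewrite ?relidE.
Qed.

Lemma relmulr1 : right_id (relid T) (@relmul T).
Proof.
move=> a; apply: relP => x y; apply/relmulP/idP => [[z xz]|xy].
  by rewrite relidE => /eqP<-.
by exists y; rewrite ?relidE.
Qed.

Lemma relmulUl a b c : relmul (a :|: b) c = relmul a c :|: relmul b c.
Proof.
apply: relP => x y; rewrite in_setU; apply/relmulP/orP.
  by case=> z; rewrite in_setU => /orP[] xz zy; [left|right]; apply/relmulP; exists z.
by case=> /relmulP[z xz zy]; exists z; rewrite // in_setU xz ?orbT.
Qed.

Lemma relmulUr a b c : relmul a (b :|: c) = relmul a b :|: relmul a c.
Proof.
apply: relP => x y; rewrite in_setU; apply/relmulP/orP.
  by case=> z xz; rewrite in_setU => /orP[] zy; [left|right]; apply/relmulP; exists z.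
by case=> /relmulP[z xz zy]; exists z; rewrite // in_setU zy ?orbT.
Qed.

Lemma relmulSS a b u v : a \subset u -> b \subset v -> relmul a b \subset relmul u v.
Proof.
move=> /subsetP sau /subsetP sbv; apply/subsetP=> -[x y] /relmulP[z xz zy].
by apply/relmulP; exists z; [apply: sau | apply: sbv].
Qed.

Lemma reltr_mul a b : reltr (relmul a b) = relmul (reltr b) (reltr a).
Proof.
apply: relP => x y; rewrite reltrE; apply/relmulP/relmulP => -[z];
  by exists z; rewrite ?reltrE // -reltrE.
Qed.

Lemma reltrU a b : reltr (a :|: b) = reltr a :|: reltr b.
Proof. by apply: relP => x y; rewrite !inE. Qed.

Lemma reltr_id : reltr (relid T) = relid T.
Proof. by apply: relP => x y; rewrite !inE eq_sym. Qed.

(** * Powers of a relation and walks *)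

Definition relpow a m := iter m (relmul a) (relid T).
Arguments relpow : simpl never.

Lemma relpowS a m : relpow a m.+1 = relmul a (relpow a m).
Proof. by []. Qed.

Lemma relpowD a m p : relpow a (m + p) = relmul (relpow a m) (relpow a p).
Proof.
elim: m => [|m IH]; first by rewrite relmul1r.
by rewrite addSn !relpowS IH relmulA.
Qed.

Lemma relpowSr a m : relpow a m.+1 = relmul (relpow a m) a.
Proof. by rewrite -addn1 relpowD relpowS relmulr1. Qed.

Lemma reltr_pow a m : reltr (relpow a m) = relpow (reltr a) m.
Proof.
elim: m => [|m IH]; first exact: reltr_id.
by rewrite relpowS reltr_mul IH relpowSr.
Qed.

Lemma relpow_comm a b m : relmul a b = relmul b a ->
  relmul a (relpow b m) = relmul (relpow b m) a.
Proof.
move=> ab; elim: m => [|m IH]; first by rewrite relmul1r relmulr1.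
by rewrite relpowS relmulA ab -relmulA IH relmulA.
Qed.

Lemma relpow_mono a m p : relid T \subset a -> m <= p -> relpow a m \subset relpow a p.
Proof.
move=> ra /subnKC<-; elim: (p - m) => [|q IH]; first by rewrite addn0.
by rewrite addnS relpowS (subset_trans IH) // -{1}[relpow a (m + q)]relmul1r relmulSS.
Qed.

(** Steps taken in [relid T] are dropped from the walk, so powers of a reflexive closure encode
    walks of bounded, not exact, length. *)
Lemma walk_of_relpow a x y m : (x, y) \in relpow (a :|: relid T) m ->
  exists p, [/\ path (Defs.arc a) x p, last x p = y & size p <= m].
Proof.
elim: m x => [|m IH] x; first by rewrite relidE => /eqP<-; exists [::].
case/relmulP=> z; rewrite in_setU relidE => xz /IH[p [pth lst sz]].
case/orP: xz => [xz|/eqP->]; last by exists p; split=> //; apply: leqW.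
by exists (z :: p); split=> //=; apply/andP.
Qed.

Lemma ddist_relpow a x y m :
  (x, y) \in relpow (a :|: relid T) m -> ddist a x y <= m.
Proof. by case/walk_of_relpow=> p [pth <- sz]; apply: leq_trans (ddist_min pth) sz. Qed.

(** A shortest undirected walk is a word in [c] and its transpose [e]. These commute, so the [c]
    steps can be moved to the front, and reflexivity pads both exponents up to [diam a]. *)
Lemma relpow_tr_full a : rel_connected a -> relmul a (reltr a) = relmul (reltr a) a ->
  let c := a :|: relid T in
  relmul (relpow c (diam a)) (relpow (reltr c) (diam a)) = setT.
Proof.
move=> conn comm c; set e := reltr c.
have eE : e = reltr a :|: relid T by rewrite /e reltrU reltr_id.
have ec : relmul e c = relmul c e.
  rewrite eE /c !(relmulUl, relmulUr) comm !relmul1r !relmulr1 -!setUA.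
  by congr (_ :|: _); rewrite setUCA.
have rc : relid T \subset c by apply: subsetUr.
have re : relid T \subset e by rewrite eE; apply: subsetUr.
have sorted_walk p x : path (Defs.arc (a :|: reltr a)) x p ->
    (x, last x p) \in relmul (relpow c (size p)) (relpow e (size p)).
  elim: p x => [|z p IH] x /=; first by rewrite relmul1r relidE.
  case/andP=> xz /IH /= zy; move: (size p) (last z p) zy => k y zy.
  have{xz}: ((x, z) \in c) || ((x, z) \in e).
    by move: xz; rewrite /Defs.arc eE /c !in_setU -!orbA => /orP[->|->]; rewrite ?orbT.
  case/orP=> xz.
    have: (x, y) \in relmul c (relmul (relpow c k) (relpow e k)).
      by apply/relmulP; exists z.
    by rewrite relmulA; apply/subsetP; apply: relmulSS; last exact: relpow_mono.
  have: (x, y) \in relmul e (relmul (relpow c k) (relpow e k)).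
    by apply/relmulP; exists z.
  (* A leading [e] step is carried past the power of [c]; the exponent of [c] is then padded to
     match that of [e]. *)
  rewrite relmulA (relpow_comm _ ec) -relmulA -relpowS.
  apply/subsetP; apply: relmulSS; first exact: relpow_mono.
  exact: subxx.
apply/setP=> -[x y]; rewrite in_setT.
have [p [pth lst sz]] := ddist_walk (conn x y).
have szp : size p <= diam a.
  rewrite sz; apply: leq_trans (leq_bigmax x).
  exact: (leq_bigmax (F := fun y => ddist (a :|: reltr a) x y) y).
have := sorted_walk _ _ pth; rewrite lst; apply/subsetP.
by rewrite relmulSS // relpow_mono.
Qed.

(** * Out-neighbourhoods and their sizes *)

Definition nbhd a x := [set y | (x, y) \in a].

(* Ruzsa's triangle inequality: double count the pairs (t, y) with t in x(uw) and
   y in t(w* v); each y in x(uv), reached through some z, contributes at least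
   the t in zw. *)
Lemma ruzsa_triangle u v w x k m :
  (forall z, k <= #|nbhd w z|) -> (forall t, #|nbhd (relmul (reltr w) v) t| <= m) ->
  #|nbhd (relmul u v) x| * k <= #|nbhd (relmul u w) x| * m.
Proof.
move=> lek lem; pose r := relmul (reltr w) v.
have -> : #|nbhd (relmul u w) x| * m = \sum_(t in nbhd (relmul u w) x) m.
  by rewrite sum_nat_const.
apply: (@leq_trans (\sum_(t in nbhd (relmul u w) x) \sum_(y in nbhd r t) 1)); last first.
  by apply: leq_sum => t _; rewrite sum1_card.
rewrite (exchange_big_dep predT) //= -sum_nat_const.
rewrite [X in _ <= X](bigID (mem (nbhd (relmul u v) x))) /=.
apply: leq_trans (leq_addr _ _); apply: leq_sum => y.
rewrite inE => /relmulP[z xz zy]; rewrite sum1_card.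
apply: leq_trans (lek z) _; apply/subset_leq_card/subsetP=> t; rewrite inE => zt.
rewrite unfold_in /= !inE; apply/andP; split; apply/existsP; exists z => /=.
  by rewrite xz.
by rewrite reltrE zt.
Qed.

End RelationAlgebra.

(** * Valencies of unions of basis relations *)

Section Scheme.
Variables (T : finType) (S : {set {set T * T}}).
Hypothesis schS : is_scheme S.
Implicit Types (a b s : {set T * T}) (p q : T * T) (x y z : T).

(** Pointwise form of being a union of relations of [S]; it passes through products without
    exhibiting a subfamily of [S]. *)
Definition block_invariant b :=
  forall s p q, s \in S -> p \in s -> q \in s -> p \in b -> q \in b.

Lemma mem_block p : p \in pblock S p.
Proof. by rewrite mem_pblock (cover_partition (scheme_partition schS)) inE. Qed.

Lemma block_mem p : pblock S p \in S.
Proof. by rewrite pblock_mem // (cover_partition (scheme_partition schS)) inE. Qed.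

Lemma block_eq s p : s \in S -> p \in s -> pblock S p = s.
Proof. by apply: def_pblock; have /and3P[] := scheme_partition schS. Qed.

Lemma block_invariant_unions b : b \in scheme_unions S -> block_invariant b.
Proof.
case/imsetP=> B; rewrite inE => /subsetP BS -> s p q sS ps qs /bigcupP[t tB pt].
apply/bigcupP; exists t => //.
by rewrite -(block_eq (BS t tB) pt) (block_eq sS ps).
Qed.

Lemma block_invariant_id : block_invariant (relid T).
Proof.
move=> s p q sS ps qs p1; rewrite -(block_eq (scheme_id schS) p1).
by rewrite (block_eq sS ps).
Qed.

Lemma block_invariantU a b :
  block_invariant a -> block_invariant b -> block_invariant (a :|: b).
Proof.
move=> ia ib s p q sS ps qs; rewrite !in_setU => /orP[/(ia s p q)->|/(ib s p q)->] //.
by rewrite orbT.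
Qed.

(** A midpoint [z] for one pair makes the intersection number of the blocks of [(x, z)] and [(z, y)]
    positive. The number is the same at the other pair of [s], which therefore has a midpoint with
    legs in the same blocks. *)
Lemma block_invariant_mul a b :
  block_invariant a -> block_invariant b -> block_invariant (relmul a b).
Proof.
move=> ia ib s [x y] [x' y'] sS ps qs /relmulP[z xz zy].
have [k kE] := scheme_intersection_number schS sS (block_mem (x, z)) (block_mem (z, y)).
have : 0 < k.
  by rewrite -(kE _ _ ps) card_gt0; apply/set0Pn; exists z; rewrite inE !mem_block.
rewrite -(kE _ _ qs) card_gt0 => /set0Pn[z']; rewrite inE => /andP[xz' zy'].
apply/relmulP; exists z'.
  exact: ia (block_mem (x, z)) (mem_block _) xz' xz.
exact: ib (block_mem (z, y)) (mem_block _) zy' zy.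
Qed.

Lemma block_invariant_pow a m : block_invariant a -> block_invariant (relpow a m).
Proof.
move=> ia; elim: m => [|m IH]; first exact: block_invariant_id.
exact: block_invariant_mul.
Qed.

(** The valency of [s] is the intersection number of [s] and [reltr s] over the diagonal. *)
Lemma block_valency s x y : s \in S -> #|nbhd s x| = #|nbhd s y|.
Proof.
move=> sS.
have [k kE] :=
  scheme_intersection_number schS (scheme_id schS) sS (scheme_tr schS sS).
have nbhdE t : nbhd s t = [set z | ((t, z) \in s) && ((z, t) \in reltr s)].
  by apply/setP=> z; rewrite !inE andbb.
by rewrite !nbhdE !kE // relidE.
Qed.

(** Sort the out-neighbours [z] by the block of [(x, z)], which lies inside [b] by invariance. This
    carries constancy of valency from blocks to their unions. *)
Lemma card_nbhd_invariant b x : block_invariant b ->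
  #|nbhd b x| = \sum_(s in S | s \subset b) #|nbhd s x|.
Proof.
move=> ib; rewrite -sum1_card.
rewrite (partition_big (fun z => pblock S (x, z)) (fun s => (s \in S) && (s \subset b))).
  apply: eq_bigr => s /andP[sS /subsetP sb]; rewrite -sum1_card.
  apply: eq_bigl => z; rewrite !inE; apply/andP/idP => [[_ /eqP<-]|xz].
    exact: mem_block.
  by rewrite (block_eq sS xz) eqxx (sb _ xz).
move=> z; rewrite inE => xz; rewrite block_mem; apply/subsetP=> q qs.
exact: ib (block_mem (x, z)) (mem_block _) qs xz.
Qed.

Lemma valency_const b x y : block_invariant b -> #|nbhd b x| = #|nbhd b y|.
Proof.
move=> ib; rewrite !card_nbhd_invariant //.
by apply: eq_bigr => s /andP[sS _]; apply: block_valency.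
Qed.

Lemma block_invariant_tr b : block_invariant b -> block_invariant (reltr b).
Proof.
move=> ib s [x y] [x' y'] sS ps qs; rewrite !reltrE.
by apply: (ib (reltr s)); rewrite ?(scheme_tr schS) ?reltrE.
Qed.

(* Both valencies times |T| count the pairs of b. *)
Lemma valency_tr b x y : block_invariant b -> #|nbhd (reltr b) x| = #|nbhd b y|.
Proof.
move=> ib; have T0 : 0 < #|T| by apply/card_gt0P; exists x.
apply/eqP; rewrite -(eqn_pmul2l T0) -!sum_nat_const; apply/eqP.
transitivity (\sum_z #|nbhd (reltr b) z|).
  by apply: eq_bigr => z _; apply: valency_const; apply: block_invariant_tr.
transitivity (\sum_z #|nbhd b z|); last by apply: eq_bigr => z _; apply: valency_const.
transitivity (\sum_z \sum_(t in nbhd (reltr b) z) 1).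
  by apply: eq_bigr => z _; rewrite sum1_card.
rewrite (exchange_big_dep predT) //=; apply: eq_bigr => t _.
by rewrite -sum1_card; apply: eq_bigl => z; rewrite !inE.
Qed.

(** * Growth of balls and the diameter bound *)

Section Diameter.
Variable a : {set T * T}.
Hypotheses (unions_a : a \in scheme_unions S) (conn_a : rel_connected a).
Hypothesis normal_a : relmul a (reltr a) = relmul (reltr a) a.

Let c := a :|: relid T.
Let d := diam a.

Let inv_pow m : block_invariant (relpow c m).
Proof.
apply/block_invariant_pow/block_invariantU; last exact: block_invariant_id.
exact: block_invariant_unions.
Qed.

(** Ruzsa's inequality with [u = c^d], [v = e^d], [w = c^m], where [e = reltr c]: [uv] is full,
    [uw = c^(m+d)], and [reltr w] times [v] is [e^(m+d)], of the same valency as [c^(m+d)]. *)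
Lemma valency_pow_growth m x :
  #|T| * #|nbhd (relpow c m) x| <= #|nbhd (relpow c (m + d)) x| ^ 2.
Proof.
have full : #|nbhd (relmul (relpow c d) (relpow (reltr c) d)) x| = #|T|.
  rewrite (relpow_tr_full conn_a normal_a) -cardsT; congr #|pred_of_set _|.
  by apply/setP=> y; rewrite !inE.
rewrite -{1}full -mulnn {1}addnC relpowD; apply: ruzsa_triangle => z.
  by rewrite (valency_const x z).
by rewrite reltr_pow -relpowD -reltr_pow (valency_tr _ x).
Qed.

(** Root-free form of [n / |c^(kd)| <= n^(1/2^k)]. The induction step raises the growth inequality
    to the power [2^k] and uses [2^(k+1) - 1 = 2^k + (2^k - 1)]. *)
Lemma valency_pow_lower k x :
  #|T| ^ (2 ^ k).-1 <= #|nbhd (relpow c (k * d)) x| ^ (2 ^ k).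
Proof.
elim: k => [|k IH].
  by rewrite expn1 card_gt0; apply/set0Pn; exists x; rewrite inE relidE.
have -> : (2 ^ k.+1).-1 = 2 ^ k + (2 ^ k).-1.
  by rewrite expnS mul2n -addnn -subn1 -addnBA ?expn_gt0 // subn1.
rewrite mulSn [d + _]addnC expnS expnM.
have grow := valency_pow_growth (k * d) x.
rewrite -(leq_exp2r _ _ (e := 2 ^ k)) ?expn_gt0 // in grow.
apply: leq_trans grow.
by rewrite expnMn expnD leq_mul2l IH orbT.
Qed.

(** Let [v] be the valency of [c^(kd)]. If [2v <= n], then [2^(2^k) v^(2^k) <= n * n^(2^k - 1) <= n
    v^(2^k)]; cancelling [v^(2^k)] contradicts the choice of [k]. *)
Lemma valency_pow_half k x : #|T| < 2 ^ (2 ^ k) ->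
  #|T| < 2 * #|nbhd (relpow c (k * d)) x|.
Proof.
rewrite !ltnNge; apply: contra => small.
have T0 : 0 < #|T| by apply/card_gt0P; exists x.
have: (2 * #|nbhd (relpow c (k * d)) x|) ^ (2 ^ k) <= #|T| ^ (2 ^ k).
  by rewrite leq_exp2r ?expn_gt0.
rewrite -[X in #|T| ^ X](prednK (n := 2 ^ k)) ?expn_gt0 // expnS expnMn => le1.
have le2 := leq_trans le1 (leq_mul (leqnn #|T|) (valency_pow_lower k x)).
by rewrite -(leq_pmul2r (m := #|nbhd (relpow c (k * d)) x| ^ (2 ^ k))) //
  (leq_trans _ (valency_pow_lower k x)) ?expn_gt0 ?T0.
Qed.

Lemma ddiam_le k : #|T| < 2 ^ (2 ^ k) -> ddiam a <= 2 * k * d.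
Proof.
move=> ltT; apply/bigmax_leqP=> x _; apply/bigmax_leqP=> y _.
apply: ddist_relpow; rewrite -/c -mulnA mul2n -addnn relpowD.
pose A := nbhd (relpow c (k * d)) x; pose B := nbhd (reltr (relpow c (k * d))) y.
(* Pigeonhole: the in-ball [B] has as many points as the out-ball [A], more than half of [T], so
   they meet. *)
have [disj|/pred0Pn[z /=]] := boolP [disjoint A & B].
  have := leq_card_setU A B; rewrite disj => -[_ /eqP cardU].
  have := max_card (A :|: B); rewrite cardU /B (valency_tr _ x) // addnn -mul2n.
  by rewrite leqNgt valency_pow_half.
rewrite /A /B 2![z \in _]inE reltrE => /andP[xz zy].
by apply/relmulP; exists z.
Qed.

End Diameter.
End Scheme.

Import Order.TTheory GRing.Theory Num.Theory.

(** * Binary logarithm and its integer truncation *)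

Section Log2.
Variable R : realType.
Implicit Types (x y : R) (j m : nat).
Local Open Scope ring_scope.

Lemma ln2_gt0 : 0 < ln (2 : R).
Proof. by apply: ln_gt0; rewrite ltr1n. Qed.

Lemma ler_log2 x y : 0 < x -> x <= y -> log2 x <= log2 y.
Proof.
move=> x0 xy; rewrite /log2 ler_pM2r ?invr_gt0 ?ln2_gt0 //.
by rewrite ler_ln ?posrE // (lt_le_trans x0).
Qed.

Lemma log2X j : log2 (2 ^+ j : R) = j%:R.
Proof. by rewrite /log2 lnXn ?ltr0n // -[ln 2 *+ j]mulr_natl mulfK // gt_eqF ?ln2_gt0. Qed.

(** The real [x] is kept apart from [m] so that the bound can be iterated: the inner logarithm is
    not an integer in general. *)
Lemma trunc_log_le_log2 m x : (0 < m)%N -> m%:R <= x -> (trunc_log 2 m)%:R <= log2 x.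
Proof.
move=> m0 mx; rewrite -log2X ler_log2 ?exprn_gt0 ?ltr0n //.
by apply: le_trans mx; rewrite -natrX ler_nat trunc_logP.
Qed.

Lemma log2_gt1 x : 2 < x -> 1 < log2 x.
Proof.
move=> x2; rewrite /log2 ltr_pdivlMr ?ln2_gt0 // mul1r ltr_ln ?posrE ?ltr0n //.
by apply: lt_trans x2; rewrite ltr0n.
Qed.

Lemma log2_gt0 x : 1 < x -> 0 < log2 x.
Proof. by move=> x1; rewrite divr_gt0 ?ln2_gt0 ?ln_gt0. Qed.

End Log2.

(** * Choice of the constant and rounding of the iterated logarithm *)

Theorem proposition3p4 (R : realType) :
  exists C : R, (0 < C)%R /\
    forall (n : nat) (T : finType) (S : {set {set T * T}}) (a : {set T * T}),
      3 <= n -> #|T| = n ->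
      is_scheme S -> a \in scheme_unions S -> rel_connected a ->
      relmul a (reltr a) = relmul (reltr a) a ->
      ((ddiam a)%:R <= C * (diam a)%:R * log2 (log2 (n%:R : R)))%R.
Proof.
pose L m : R := log2 (log2 m%:R).
have L3 : (0 < L 3)%R by rewrite /L log2_gt0 // log2_gt1 // ltr_nat.
(* With [k <= L n] and [1 <= L n / L 3], the bound [2 (k + 1) d] is at most [(2 + 2 / L 3) d L n];
   the second summand absorbs the rounding [+ 1]. *)
exists (2 + 2 / L 3)%R; split.
  by apply: addr_gt0; rewrite ?ltr0n //; apply: divr_gt0; rewrite ?ltr0n.
move=> n T S a n3 cardT schS aS conn comm.
(* Truncation rounds down, so [k.+1] is what makes [n < 2^(2^k.+1)] hold strictly. *)
pose k := trunc_log 2 (trunc_log 2 n).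
have n0 : 0 < n by apply: leq_trans n3.
have ltT : #|T| < 2 ^ (2 ^ k.+1).
  rewrite cardT; apply: leq_trans (trunc_log_ltn n (leqnn 2)) _.
  by rewrite leq_exp2l // trunc_log_ltn.
have log3 : (1 < log2 (3 : R))%R by rewrite log2_gt1 // ltr_nat.
have L3n : (L 3 <= L n)%R.
  rewrite /L ler_log2 ?(lt_trans ltr01) //.
  by rewrite ler_log2 ?ltr0n ?ler_nat.
have kL : (k%:R <= L n)%R.
  rewrite /k /L; apply: trunc_log_le_log2; last exact: trunc_log_le_log2.
  by rewrite trunc_log_gt0 /= (leq_trans _ n3).
have le1 : (1 <= L n / L 3)%R by rewrite ler_pdivlMr // mul1r.
apply: (@le_trans _ _ (2 * k.+1 * diam a)%:R%R).
  by rewrite ler_nat; apply: (ddiam_le schS).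
rewrite -/(L n) !natrM [leRHS]mulrAC ler_wpM2r //.
rewrite -[k.+1%:R%R]natr1 [leLHS]mulrDr [leRHS]mulrDl mulr1 lerD //.
  by rewrite ler_pM2l ?ltr0n.
by rewrite -[leRHS]mulrA [(_^-1 * _)%R]mulrC ler_peMr ?ler0n.
Qed.
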